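(* Let $S$ be a finite semilattice. Then $$N(S)=N'(S)=M(S)=M'(S)=N(S,I(S)).$$
   Context: A semilattice is a non-empty commutative semigroup all of whose elements are idempotent. An element $s$ of a semilattice $S$ is irreducible if $s=ab$ with $a,b\in S$ implies $a=s$ or $b=s$; $I(S)$ is the set of all irreducible elements of $S$ (it is a generating set of $S$ when $S$ is finite). A generating set of a finite semigroup $S$ is a non-empty subset $A\subseteq S$ such that every element of $S$ is a product of one or more elements of $A$; it is minimal if no proper subset is a generating set; $\mathrm{rank}(S)$ is the smallest cardinality of a generating set. For a generating set $A$ and $s\in S$, the length $l_A(s)$ is the least $k$ such that $s=a_1\cdots a_k$ with $a_i\in A$, except that the identity element of $S$ (if there is one) has length $0$ by convention. $\ker(S)$ is the minimum ideal of $S$ and $N(S,A)=\min\{l_A(s): s\in\ker(S)\}$. The depth parameters are: $N(S)$ and $M(S)$, respectively the minimum and the maximum of $N(S,A)$ over all generating sets $A$ with $|A|=\mathrm{rank}(S)$; $N'(S)$ and $M'(S)$, respectively the minimum and the maximum of $N(S,A)$ over all minimal generating sets $A$. *)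

(* Defs.v *)
From HB Require Import structures.
From mathcomp Require Import all_boot boolp.

Set Implicit Arguments.
Unset Strict Implicit.
Unset Printing Implicit Defensive.

Local Open Scope group_scope.

#[short(type="finSemigroupType")]
HB.structure Definition FinSemigroup := {G of Semigroup G & Finite G}.

(* Least element of a set of naturals; the value on the empty set is junk, and
   the sets below are never empty for a nonempty S and a generating A, see
   products_ex, rankP, kernel_neq0 and minimal_generating_ex. *)
Definition nat_min (P : nat -> Prop) : nat :=
  if pselect (exists n, `[< P n >]) is left exP then ex_minn exP else 0.

Lemma nat_minP (P : nat -> Prop) :
  (exists n, P n) -> P (nat_min P) /\ forall n, P n -> nat_min P <= n.
Proof.
move=> [n Pn]; rewrite /nat_min; case: pselect => [exP | []]; last first.
  by exists n; apply/asboolP.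
case: ex_minnP => m /asboolP Pm minm; split=> // k Pk.
by apply: minm; apply/asboolP.
Qed.

Section Semigroup.

Variable S : finSemigroupType.
Implicit Types (A B I : {set S}) (s : S).

Definition semilattice : Prop :=
  [/\ 0 < #|S|, commutative (@mul S) & forall x : S, x * x = x].

Definition is_identity s : bool :=
  [forall x : S, (s * x == x) && (x * s == x)].

Definition irreducible s : bool :=
  [forall a : S, forall b : S, (s == a * b) ==> (a == s) || (b == s)].

Definition irreducibles : {set S} := [set s | irreducible s].

(* s = a_1 * ... * a_k with all a_i in A and k >= 1; the word is a :: w. *)
Definition product_of_length A (k : nat) s : Prop :=
  exists (a : S) (w : seq S),
    [/\ {subset a :: w <= A}, size (a :: w) = k & foldl mul a w = s].

Definition generating A : Prop :=
  A != set0 /\ forall s, exists k, product_of_length A k s.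

Definition minimal_generating A : Prop :=
  generating A /\ forall B, B \proper A -> ~ generating B.

Definition rank : nat :=
  nat_min (fun n => exists2 A, generating A & #|A| = n).

Definition rank_generating A : Prop := generating A /\ #|A| = rank.

Definition word_length A s : nat :=
  if is_identity s then 0 else nat_min (fun k => product_of_length A k s).

Definition ideal I : bool :=
  (I != set0) &&
  [forall x : S, forall y in I, (x * y \in I) && (y * x \in I)].

(* On a finite nonempty S this intersection is itself an ideal (kernel_ideal),
   hence the minimum ideal. *)
Definition kernel : {set S} := \bigcap_(I : {set S} | ideal I) I.

Definition depth A : nat :=
  nat_min (fun n => exists2 s, s \in kernel & word_length A s = n).

Definition depth_N : nat :=
  nat_min (fun n => exists2 A, rank_generating A & depth A = n).

Definition depth_M : nat :=
  \max_(A : {set S} | `[< rank_generating A >]) depth A.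

Definition depth_N' : nat :=
  nat_min (fun n => exists2 A, minimal_generating A & depth A = n).

Definition depth_M' : nat :=
  \max_(A : {set S} | `[< minimal_generating A >]) depth A.

Lemma products_ex A s : generating A -> exists k, product_of_length A k s.
Proof. by case=> _ /(_ s). Qed.

Lemma generatingT : 0 < #|S| -> generating [set: S].
Proof.
move=> S_gt0; split; first by rewrite -card_gt0 cardsT.
by move=> s; exists 1%N, s, [::]; split=> // x _; rewrite inE.
Qed.

Lemma rankP : 0 < #|S| -> exists A, rank_generating A.
Proof.
move=> /generatingT gT.
have [|[A gA cA] _] := @nat_minP (fun n => exists2 A, generating A & #|A| = n).
  by exists #|[set: S]|, [set: S].
by exists A.
Qed.

Lemma rank_generating_minimal A : rank_generating A -> minimal_generating A.
Proof.
move=> [gA cA]; split=> // B /proper_card ltBA gB.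
have [|_ minr] := @nat_minP (fun n => exists2 A, generating A & #|A| = n).
  by exists #|B|, B.
move: ltBA; rewrite cA ltnNge => /negP; apply.
by apply: minr; exists B.
Qed.

Lemma minimal_generating_ex : 0 < #|S| -> exists A, minimal_generating A.
Proof. by case/rankP=> A /rank_generating_minimal; exists A. Qed.

Lemma idealP I :
  reflect (I != set0 /\ forall x y, y \in I -> x * y \in I /\ y * x \in I)
          (ideal I).
Proof.
apply: (iffP andP) => -[I0 H]; split=> //.
  by move=> x y yI; move/forallP/(_ x)/forall_inP/(_ y yI)/andP: H.
by apply/forallP=> x; apply/forall_inP=> y /(H x) [-> ->].
Qed.

Lemma kernel_neq0 : 0 < #|S| -> kernel != set0.
Proof.
case/card_gt0P=> x0 _.
pose p := foldl mul x0 (enum S).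
suff pI I : ideal I -> p \in I.
  by apply/set0Pn; exists p; apply/bigcapP=> I /pI.
case/idealP=> /set0Pn[y yI] clI.
have stay w z : z \in I -> foldl mul z w \in I.
  by elim: w z => //= x w IHw z /(clI x)[_ /IHw].
have : y \in enum S by rewrite mem_enum.
rewrite /p; case/splitPr=> w1 w2; rewrite foldl_cat /=.
by apply: stay; have [] := clI (foldl mul x0 w1) y yI.
Qed.

Lemma kernel_ideal : 0 < #|S| -> ideal kernel.
Proof.
move=> /kernel_neq0 k0; apply/idealP; split=> // x y /bigcapP yk.
by split; apply/bigcapP=> I idI; have [_ cl] := idealP _ idI;
   have [] := cl x y (yk I idI).
Qed.

Lemma kernel_min I : ideal I -> kernel \subset I.
Proof. exact: bigcap_inf. Qed.

End Semigroup.

Arguments semilattice S : clear implicits.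
Arguments irreducibles S : clear implicits.
Arguments rank S : clear implicits.
Arguments kernel S : clear implicits.
Arguments depth_N S : clear implicits.
Arguments depth_M S : clear implicits.
Arguments depth_N' S : clear implicits.
Arguments depth_M' S : clear implicits.

(* Main.v *)
Require Import Defs.
From mathcomp Require Import all_boot boolp.

Set Implicit Arguments.
Unset Strict Implicit.
Unset Printing Implicit Defensive.

Local Open Scope group_scope.

(** A finite semilattice has exactly one minimal generating set, namely its
    set I of irreducible elements, so all five numbers are the depth of I.

    In any semigroup a word whose product is irreducible has that product among
    its letters, so every generating set contains I
    ([irreducibles_sub_generating]).  In a finite semilattice I generates
    ([generating_irreducibles]): for the order in which x lies below y when
    x * y = x, a reducible element is a product of two elements strictly above
    it, and finiteness makes the repeated factorisation stop.  Hence a minimal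
    generating set is I ([minimal_generating_irreducibles]); generating sets of
    least cardinality are minimal, so they are I as well, and the minima and
    maxima in the depth parameters range over the single value [depth I]. *)

Section IrreducibleLetters.

Variable S : finSemigroupType.
Implicit Types (A : {set S}) (s t : S).

Lemma foldl_mulA s t (w : seq S) : foldl mul (s * t) w = s * foldl mul t w.
Proof. by elim: w t => //= b w IHw t; rewrite -mulgA IHw. Qed.

Lemma product_of_lengthM A k l s t :
  product_of_length A k s -> product_of_length A l t ->
  product_of_length A (k + l) (s * t).
Proof.
move=> [a [v [vA <- <-]]] [b [w [wA <- <-]]]; exists a, (v ++ b :: w).
split; last by rewrite foldl_cat /= foldl_mulA.
  by move=> x; rewrite -cat_cons mem_cat => /orP[/vA | /wA].
by rewrite /= size_cat.
Qed.

(** Merging the first two letters of a word into their product keeps its value;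
    if the merged letter is s, irreducibility makes one of the two equal to s. *)
Lemma irreducible_letter s a (w : seq S) :
  irreducible s -> foldl mul a w = s -> s \in a :: w.
Proof.
move=> /forallP irr_s; elim: w a => [|b w IHw] a /=.
  by move=> ->; rewrite mem_head.
move/IHw; rewrite !inE => /predU1P[s_ab|->]; last by rewrite !orbT.
have /forallP/(_ b) := irr_s a.
by rewrite -s_ab eqxx /= !(eq_sym _ s) => /orP[]->; rewrite ?orbT.
Qed.

Lemma irreducibles_sub_generating A : generating A -> irreducibles S \subset A.
Proof.
move=> [_ genA]; apply/subsetP=> s; rewrite inE => irr_s.
have [_ [a [w [wA _ w_s]]]] := genA s.
exact: wA (irreducible_letter irr_s w_s).
Qed.

End IrreducibleLetters.

Section Semilattice.

Variable S : finSemigroupType.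
Hypothesis slS : semilattice S.

(** Passing to a proper factor strictly shrinks the set of elements above,
    which is the measure for the induction in [generating_irreducibles]. *)
Lemma upset_factor_proper (s a b : S) : s = a * b -> a != s ->
  [set x | a * x == a] \proper [set x | s * x == s].
Proof.
have [_ mulC mulxx] := slS.
move=> s_ab a's; apply/properP; split.
  apply/subsetP=> x; rewrite !inE => /eqP ax.
  by rewrite s_ab (mulC a b) -mulgA ax.
(* s is not above a: a * s = s as s is a multiple of a, so a * s = a would
   give a = s. *)
exists s; rewrite inE ?mulxx //.
by apply: contra a's => /eqP as_a; rewrite -as_a {1}s_ab mulgA mulxx -s_ab.
Qed.

Lemma generating_irreducibles : generating (irreducibles S).
Proof.
have [S_gt0 mulC mulxx] := slS.
have gen s : exists k, product_of_length (irreducibles S) k s.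
  have [n] := ubnP #|[set x | s * x == s]|; elim: n s => // n IHn s le_s.
  have [irr_s|] := boolP (irreducible s).
    by exists 1%N, s, [::]; split=> // x; rewrite !inE => /eqP->.
  case/forallPn=> a /forallPn[b].
  rewrite negb_imply negb_or => /andP[/eqP s_ab /andP[a's b's]].
  have s_ba : s = b * a by rewrite mulC.
  have [k a_k] :=
    IHn a (leq_trans (proper_card (upset_factor_proper s_ab a's)) le_s).
  have [l b_l] :=
    IHn b (leq_trans (proper_card (upset_factor_proper s_ba b's)) le_s).
  by exists (k + l); rewrite s_ab; apply: product_of_lengthM.
(* Words are nonempty, so any element of S yields an irreducible letter. *)
split=> //; have /card_gt0P[s _] := S_gt0.
have [_ [a [w [wI _ _]]]] := gen s.
by apply/set0Pn; exists a; apply: wI; rewrite mem_head.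
Qed.

Lemma minimal_generating_irreducibles (A : {set S}) :
  minimal_generating A -> A = irreducibles S.
Proof.
move=> [genA minA]; have sIA := irreducibles_sub_generating genA.
apply/eqP; rewrite eq_sym eqEproper sIA /=; apply/negP=> /minA; apply.
exact: generating_irreducibles.
Qed.

End Semilattice.

Section SingleSet.

Variables (T : finType) (P : {set T} -> Prop) (I : {set T}).
Variable f : {set T} -> nat.
Hypotheses (exP : exists A, P A) (uniqP : forall A, P A -> A = I).

Lemma nat_min_single : nat_min (fun n => exists2 A, P A & f A = n) = f I.
Proof.
have [A PA] := exP.
have [|[B PB <-] _] := @nat_minP (fun n => exists2 A, P A & f A = n).
  by exists (f A), A.
by rewrite (uniqP PB).
Qed.

Lemma bigmax_single : \max_(A : {set T} | `[< P A >]) f A = f I.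
Proof.
have [A PA] := exP; rewrite (big_pred1 I) // => B /=.
apply/asboolP/eqP=> [/uniqP // | ->].
by rewrite -(uniqP PA).
Qed.

End SingleSet.

Theorem corollary3p4 (S : finSemigroupType) (hS : semilattice S) :
  [/\ depth_N S = depth_N' S,
      depth_N' S = depth_M S,
      depth_M S = depth_M' S
    & depth_M' S = depth (irreducibles S)].
Proof.
have [S_gt0 _ _] := hS.
have minI := minimal_generating_irreducibles hS.
have rankI (A : {set S}) : rank_generating A -> A = irreducibles S.
  by move/rank_generating_minimal/minI.
have ex_rank := rankP S_gt0; have ex_min := minimal_generating_ex S_gt0.
rewrite /depth_N /depth_N' /depth_M /depth_M'.
by rewrite !(nat_min_single _ ex_rank rankI, nat_min_single _ ex_min minI,
             bigmax_single _ ex_rank rankI, bigmax_single _ ex_min minI).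
Qed.
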